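(* Let $\Pi=(\Pi_n)_{n\ge1}$ be an exchangeable random partition of $\mathbb{N}$ with EPPF $\mathfrak{q}$, let $(Z_n)_{n\ge1}$ be i.i.d. random variables with law $H$ on a Polish space $\mathbb{X}$, independent of $\Pi$, and let $\tilde\Pi=(\tilde\Pi_n)_{n\ge1}$ be the random partition induced by the sequence $\xi_n=Z_{\mathscr{C}_n(\Pi)}$, $n\ge1$ (which is a $gSSS(\mathfrak{q},H)$). Let $\mathbb{X}_0=\{x\in\mathbb{X}:H(\{x\})>0\}$ and $a=H(\mathbb{X}_0)$, with $a>0$. Assume that there are a deterministic sequence $(c_n)_{n\geq 1}$ of positive numbers with $c_n\to+\infty$ and a strictly positive random variable $S$ such that $|\Pi_n|/c_n\to S$ a.s., and that $|\mathbb{X}_0|<+\infty$. Then $$\frac{|\tilde\Pi_n|}{c_n}\to(1-a)S\quad\text{a.s. if } a<1,$$ and $$|\tilde\Pi_n|\to|\mathbb{X}_0|\quad\text{a.s. if } a=1.$$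
   Context: A random partition of $\mathbb{N}$ is a sequence $\Pi=(\Pi_n)_{n\ge1}$ of random partitions of $[n]=\{1,\dots,n\}$ consistent under restriction, with blocks $\Pi_{1,n},\Pi_{2,n},\dots$ listed in increasing order of smallest elements; $|\Pi_n|$ is the number of blocks. It is exchangeable if the law of each $\Pi_n$ is invariant under permutations of $[n]$; its EPPF is the symmetric function $\mathfrak{q}$ with $P\{\Pi_n=\pi_n\}=\mathfrak{q}(|\pi_{1,n}|,\dots,|\pi_{k,n}|)$ for each partition $\pi_n$ of $[n]$ with $k$ blocks. $\mathscr{C}_n(\Pi)=c$ if $n\in\Pi_{c,n}$. The random partition induced by $(\xi_n)$ is given by $i\sim j$ iff $\xi_i=\xi_j$. A $gSSS(\mathfrak{q},H)$ is a sequence conditionally i.i.d. given a random probability measure of the form $\sum_jp_j\delta_{Y_j}$ with $(Y_j)$ i.i.d. from $H$, independent of weights $(p_j)$ in $[0,1]$ with $\sum_jp_j=1$ a.s. whose decreasing rearrangement corresponds to $\mathfrak{q}$ via Kingman's correspondence. Standing assumption: the a.s. limits $p_j^\downarrow$ of (the $j$-th largest block size of $\Pi_n$)$/n$ satisfy $\sum_jp_j^\downarrow=1$ a.s. *)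

(* Defs.v *)
From mathcomp Require Export all_boot all_order fingroup perm all_algebra finmap.
From mathcomp Require Export all_classical all_reals all_analysis.
Export Order.TTheory GRing.Theory Num.Theory.
Export numFieldNormedType.Exports.

Set Implicit Arguments.
Unset Strict Implicit.
Unset Printing Implicit Defensive.

Local Open Scope classical_set_scope.
Local Open Scope ring_scope.

(* The set [n] = {1, ..., n} is encoded by 'I_n, the element m of [n] being the
   ordinal of value m.-1.  Cluster labels and the variables Z_1, Z_2, ... are
   likewise numbered from 0. *)

Section Partitions.
Variable n : nat.
Implicit Types (B : {set 'I_n}) (pi : {set {set 'I_n}}).

Definition block_min B : nat := \big[minn/n]_(i in B) (i : nat).

Definition ordered_blocks pi : seq {set 'I_n} :=
  sort (fun B C => block_min B <= block_min C)%N (enum pi).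

Definition block_sizes pi : seq nat :=
  map (fun B : {set 'I_n} => #|B|) (ordered_blocks pi).

(* Value 0 when pi has at most j blocks. *)
Definition nth_largest_block_size pi (j : nat) : nat :=
  nth 0%N (sort geq (block_sizes pi)) j.

Definition permute_partition (s : 'S_n) pi : {set {set 'I_n}} :=
  [set s @: (B : {set 'I_n}) | B in pi]%SET.

Definition restrict_partition (m : nat) (le_mn : (m <= n)%N) pi :
    {set {set 'I_m}} :=
  ([set widen_ord le_mn @^-1: (B : {set 'I_n}) | B in pi] :\ finset.set0)%SET.

End Partitions.

Section Polish.
Context {R : realType} {X : topologicalType}.
Implicit Type dist : X -> X -> R.

Definition is_metric dist : Prop :=
  [/\ forall x, dist x x = 0,
      forall x y, dist x y = 0 -> x = y,
      forall x y, dist x y = dist y x &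
      forall x y z, dist x z <= dist x y + dist y z].

Definition metrizes_topology dist : Prop :=
  forall (x : X) (A : set X),
    nbhs x A <-> exists2 e : R, 0 < e & [set y | dist x y < e] `<=` A.

Definition complete_metric dist : Prop :=
  forall u : nat -> X,
    (forall e : R, 0 < e ->
       exists N, forall i j, (N <= i)%N -> (N <= j)%N -> dist (u i) (u j) < e) ->
    exists l : X, u @ \oo --> l.

End Polish.

Definition polish_space (R : realType) (X : topologicalType) : Prop :=
  (exists2 D : set X, countable D & dense D) /\
  exists dist : X -> X -> R,
    [/\ is_metric dist, metrizes_topology dist & complete_metric dist].

Notation borel X := (g_sigma_algebraType (@open X)).

Section Independence.
Context {d : measure_display} {Omega : measurableType d} {R : realType}.
Variable P : probability Omega R.

Definition mutually_independent (I : choiceType)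
    (F : I -> set_system Omega) : Prop :=
  forall (J : {fset I}) (A : I -> set Omega),
    (forall i, i \in J -> F i (A i)) ->
    P (\bigcap_(i in [set` J]) A i) = (\prod_(i <- J) P (A i))%E.

Definition independent_systems (F G : set_system Omega) : Prop :=
  forall A B, F A -> G B -> P (A `&` B) = (P A * P B)%E.

End Independence.

Section RandomVariables.
Context {d d' : measure_display} {Omega : measurableType d}
  {T : measurableType d'} {R : realType}.
Variable P : probability Omega R.

Definition iid_with_law (H : probability T R) (Z : nat -> {RV P >-> T}) : Prop :=
  mutually_independent P
    (fun i => preimage_set_system setT (Z i : Omega -> T) measurable) /\
  forall i A, measurable A -> distribution P (Z i) A = H A.

Definition sigma_variables (Z : nat -> {RV P >-> T}) : set_system Omega :=
  <<s \bigcup_i preimage_set_system setT (Z i : Omega -> T) measurable >>.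

End RandomVariables.

Section RandomPartition.
Context {d : measure_display} {Omega : measurableType d} {R : realType}.
Variable P : probability Omega R.
Implicit Type Pi : forall n : nat, Omega -> {set {set 'I_n}}.

(* The index n = 0, absent from the usual definition, carries no information:
   the only partition of the empty set is the empty one. *)
Definition random_partition Pi : Prop :=
  [/\ forall n w, finset.partition (Pi n w) [set: 'I_n]%SET,
      forall n pi, measurable [set w | Pi n w = pi] &
      forall m n (le_mn : (m <= n)%N) w,
        restrict_partition le_mn (Pi n w) = Pi m w].

Definition sigma_partition Pi : set_system Omega :=
  <<s [set A | exists n (pi : {set {set 'I_n}}), A = [set w | Pi n w = pi]] >>.

Definition exchangeable Pi : Prop :=
  forall n (s : 'S_n) (pi : {set {set 'I_n}}),
    P [set w | permute_partition s (Pi n w) = pi] = P [set w | Pi n w = pi].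

(* q is a symmetric function of finite sequences of positive integers; its
   values on sequences containing 0 are irrelevant. *)
Definition is_EPPF Pi (q : seq nat -> R) : Prop :=
  (forall s t : seq nat, 0%N \notin s -> perm_eq s t -> q s = q t) /\
  forall n (pi : {set {set 'I_n}}),
    (0 < n)%N -> finset.partition pi [set: 'I_n]%SET ->
    P [set w | Pi n w = pi] = (q (block_sizes pi))%:E.

Definition ranked_frequencies Pi (w : Omega) (p : nat -> R) : Prop :=
  forall j, (nth_largest_block_size (Pi n w) j)%:R / n%:R @[n --> \oo] --> p j.

Definition proper_frequencies Pi : Prop :=
  {ae P, forall w,
    exists2 p : nat -> R, ranked_frequencies Pi w p & series p @ \oo --> (1 : R)}.

(* For i : nat, the (0-based) index, among the blocks of Pi_{i+1} listed in
   order of their least elements, of the block containing the last element of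
   [i+1]. *)
Definition cluster_label Pi (i : nat) (w : Omega) : nat :=
  find (fun B : {set 'I_i.+1} => ord_max \in B) (ordered_blocks (Pi i.+1 w)).

End RandomPartition.

Definition induced_partition (Omega : Type) (T : eqType) (xi : nat -> Omega -> T)
    (n : nat) (w : Omega) : {set {set 'I_n}} :=
  preim_partition (fun i : 'I_n => xi i w) [set: 'I_n]%SET.

Section Atoms.
Context {d : measure_display} {T : measurableType d} {R : realType}.

Definition atoms (H : probability T R) : set T :=
  [set x | (0 < H [set x])%E].

Definition atomic_mass (H : probability T R) : R := fine (H (atoms H)).

End Atoms.

(* Main.v *)
Require Import Defs.
From mathcomp Require Import measurable_realfun.
From mathcomp Require Import zify ring lra.
Set Implicit Arguments.
Unset Strict Implicit.
Unset Printing Implicit Defensive.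
Local Open Scope classical_set_scope.
Local Open Scope ring_scope.

(** Write K_n for the number of blocks of Pi_n and D_k for the number of distinct
    values among the first k of the variables Z.  Cluster labels are handed out
    consecutively, so the labels of the elements of [n] are exactly the first K_n
    ones (labels_fill_interval), and the induced partition has D_{K_n} blocks
    (card_induced_partition).  As K_n / c_n tends to S > 0 and c_n to infinity,
    K_n tends to infinity, and everything reduces to the asymptotics of D_k:
    D_{K_n} / c_n = (D_{K_n} / K_n) (K_n / c_n).

    Almost surely, Z_i and Z_j with i <> j coincide only at an atom of H: their
    joint law is the product of H with itself, under which the diagonal,
    measurable in the product of a Polish space with itself, has no mass outside
    the atoms (ae_atom_of_eq, measurable_diagonal).  Hence D_k is the number of
    i < k with Z_i not an atom, plus the number of atoms seen, which is at most
    the number of atoms.  By the strong law of large numbers for events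
    (slln_events) D_k / k tends to 1 - a.  If a = 1, almost surely every Z_i is an
    atom and, by the same law, every atom is eventually seen, so that D_k is
    eventually the number of atoms.

    The strong law is proved for pairwise independent events of probability p.
    The number of the first n events that occur has variance n (p - p^2), so the
    squared deviations of the averages along n = k^2 have summable expectations
    and tend to 0 almost surely; the counts moving by at most one at each step,
    convergence along the squares implies convergence. *)

(** * Cluster labels and the blocks of the induced partition *)

Section Labels.
Local Open Scope nat_scope.

Lemma block_min_le n (B : {set 'I_n}) (j : 'I_n) : j \in B -> block_min B <= j.
Proof.
move=> jB; rewrite /block_min.
have: j \in index_enum 'I_n by rewrite mem_index_enum.
elim: (index_enum _) => // i r IH; rewrite inE big_cons => /orP[/eqP <-|/IH le_r].
  by rewrite jB geq_minl.
by case: ifP => // _; rewrite geq_min le_r orbT.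
Qed.

Lemma block_min_set1_ge n (i : 'I_n) : i <= block_min [set i]%SET.
Proof.
rewrite /block_min; apply: (big_ind (fun m => i <= m)) => [|m p im ip|j].
- exact/ltnW/ltn_ord.
- by rewrite leq_min im.
- by rewrite inE => /eqP ->.
Qed.

Lemma ordered_blocks_size n (pi : {set {set 'I_n}}) :
  size (ordered_blocks pi) = #|pi|.
Proof. by rewrite size_sort -cardE. Qed.

Lemma mem_ordered_blocks n (pi : {set {set 'I_n}}) B :
  (B \in ordered_blocks pi) = (B \in pi).
Proof. by rewrite mem_sort mem_enum. Qed.

Variable n : nat.
Variable pi : {set {set 'I_n.+1}}.
Hypothesis part : finset.partition pi [set: 'I_n.+1]%SET.

Let label := find (fun B : {set 'I_n.+1} => ord_max \in B) (ordered_blocks pi).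

Lemma last_label_lt : label < #|pi|.
Proof.
rewrite -ordered_blocks_size -has_find; apply/hasP.
have /and3P[/eqP cov _ _] := part.
have : ord_max \in finset.cover pi by rewrite cov finset.in_setT.
by move=> /bigcupP[B Bpi oB]; exists B; rewrite ?mem_ordered_blocks.
Qed.

(** The last element is larger than the minimum of any other block, so a
    singleton block made of it comes last in order of appearance. *)
Lemma last_label_singleton :
  [set ord_max]%SET \in pi -> label.+1 = #|pi|.
Proof.
move=> mpi; have := last_label_lt; rewrite leq_eqVlt => /orP[/eqP//|lt_label].
exfalso; have /and3P[_ /finset.trivIsetP tri n0] := part.
have lab_lt : label < size (ordered_blocks pi).
  by rewrite ordered_blocks_size last_label_lt.
have has_max : has (fun B : {set 'I_n.+1} => ord_max \in B) (ordered_blocks pi).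
  by rewrite has_find.
set s := ordered_blocks pi in lab_lt has_max.
have lastB : nth finset.set0 s label = [set ord_max]%SET.
  apply/eqP/negPn/negP => neq.
  have Bpi : nth finset.set0 s label \in pi.
    by rewrite -mem_ordered_blocks mem_nth.
  have := tri _ _ Bpi mpi neq.
  rewrite -finset.setI_eq0 => /eqP/setP/(_ ord_max).
  rewrite !inE eqxx andbT => /negP[].
  exact: (nth_find finset.set0 has_max).
have srt : sorted (fun B C : {set 'I_n.+1} => block_min B <= block_min C) s.
  by apply: sort_sorted => B C; exact: leq_total.
have lt2 : label.+1 < size s by rewrite ordered_blocks_size.
(* The next block in the list would also have only the last element. *)
have := sorted_ltn_nth (fun _ _ _ => @leq_trans _ _ _) finset.set0 srt.
move=> /(_ label label.+1 lab_lt lt2 (ltnSn _)); rewrite lastB.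
set C := nth _ _ _ => /(leq_trans (block_min_set1_ge _)) /= leC.
have Cpi : C \in pi by rewrite -mem_ordered_blocks mem_nth.
have CE : C = [set ord_max]%SET.
  have C0 : C != finset.set0 by apply: contraNneq n0 => <-.
  have all_max j : j \in C -> j = ord_max.
    move=> jC; apply/val_inj => /=; apply/eqP; rewrite eqn_leq -ltnS ltn_ord /=.
    rewrite leqNgt; apply/negP => jn; move: leC; rewrite leqNgt => /negP; apply.
    exact: leq_ltn_trans (block_min_le jC) jn.
  have [j jC] := finset.set0Pn _ C0.
  apply/setP => k; rewrite inE; apply/idP/eqP; first exact: all_max.
  by move=> ->; rewrite -(all_max _ jC).
have us : uniq s by rewrite sort_uniq enum_uniq.
have := nth_uniq finset.set0 lab_lt lt2 us.
by rewrite lastB -/C CE eqxx => /esym/eqP; lia.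
Qed.

(** Restricting to [n] empties the block reduced to the last element and keeps
    all the others nonempty and distinct. *)
Lemma card_restrict_partition (le_n : n <= n.+1) :
  #|restrict_partition le_n pi| = #|(pi :\ [set ord_max])%SET|.
Proof.
have /and3P[_ /finset.trivIsetP tri n0] := part.
pose f (B : {set 'I_n.+1}) := (widen_ord le_n @^-1: B)%SET.
have f0 B : B \in pi -> (f B == finset.set0) = (B == [set ord_max]%SET).
  move=> Bpi; apply/eqP/eqP => [fB0|->]; last first.
    apply/setP => j; rewrite !inE; apply/eqP => /(congr1 val) /=.
    by have := ltn_ord j; lia.
  have B0 : B != finset.set0 by apply: contraNneq n0 => <-.
  have all_max j : j \in B -> j = ord_max.
    move=> jB; apply/val_inj => /=; apply/eqP; rewrite eqn_leq -ltnS ltn_ord /=.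
    rewrite leqNgt; apply/negP => jn.
    move/setP/(_ (Ordinal jn)): fB0; rewrite !inE => /negP; apply.
    by rewrite (_ : widen_ord _ _ = j) //; exact: val_inj.
  have [j jB] := finset.set0Pn _ B0.
  apply/setP => k; rewrite inE; apply/idP/eqP; first exact: all_max.
  by move=> ->; rewrite -(all_max _ jB).
have -> : restrict_partition le_n pi = (f @: (pi :\ [set ord_max]))%SET.
  apply/setP => C; rewrite !inE; apply/andP/imsetP => [[C0 /imsetP[B Bpi CE]]|].
    by exists B => //; rewrite !inE Bpi andbT -f0 // /f -CE.
  move=> [B]; rewrite !inE => /andP[Bm Bpi] ->; split; first by rewrite f0.
  by apply/imsetP; exists B.
rewrite card_in_imset // => B C; rewrite !inE => /andP[Bm Bpi] /andP[Cm Cpi] fBC.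
apply/eqP/negPn/negP => /(tri _ _ Bpi Cpi).
have := f0 _ Bpi; rewrite (negbTE Bm) => /negbT /finset.set0Pn[j jB].
have jC : j \in f C by rewrite -fBC.
rewrite -finset.setI_eq0 => /eqP/setP/(_ (widen_ord le_n j)).
by move: jB jC; rewrite !inE => -> ->.
Qed.

(** By cases on whether the last element is a block by itself, the only case in
    which the restriction to [n] loses a block. *)
Lemma last_label_cases (le_n : n <= n.+1) (k := #|restrict_partition le_n pi|) :
  (label = k /\ #|pi| = k.+1) \/ (label < k /\ #|pi| = k).
Proof.
rewrite /k card_restrict_partition.
have := cardsD1 [set ord_max]%SET pi; set k' := #|(pi :\ _)%SET|.
have [mpi|mpi] := boolP ([set ord_max]%SET \in pi) => piE.
  left; have := last_label_singleton mpi.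
  by rewrite piE add1n => -[].
by right; have := last_label_lt; rewrite piE add0n.
Qed.

End Labels.

(** A new cluster takes the first free label, by last_label_cases.  This is what
    turns the blocks of the induced partition into the distinct values of an
    initial segment of Z. *)
Lemma labels_fill_interval d (Omega : measurableType d)
    (Pi : forall n : nat, Omega -> {set {set 'I_n}}) (w : Omega) (n : nat) :
  random_partition Pi ->
  [seq cluster_label Pi i w | i <- iota 0 n] =i iota 0 #|Pi n w|.
Proof.
move=> [Ppart _ Prestr]; elim: n => [|n IH] x.
  have -> : #|Pi 0%N w| = 0%N; last by [].
  apply: eq_card0 => B; apply/negP => BPi.
  have /and3P[_ _ n0] := Ppart 0%N w.
  have /finset.set0Pn[[]//] : B != finset.set0.
  by apply: contraNneq n0 => <-.
have := @last_label_cases n (Pi n.+1 w) (Ppart _ w) (leqnSn n).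
rewrite Prestr -/(cluster_label Pi n w) => lab.
rewrite -addn1 iotaD map_cat mem_cat IH /= !inE !mem_iota /= !add0n addn1.
case: lab => -[l1 ->]; first by rewrite l1 orbC ltnS -leq_eqVlt.
by have [->|_] := eqVneq x (cluster_label Pi n w); rewrite ?orbF // l1.
Qed.

Lemma card_preim_partition (I : finType) (T : eqType) (f : I -> T) :
  #|preim_partition f [set: I]%SET| = size (undup [seq f i | i <- enum I]).
Proof.
pose fiber t := [set y in [set: I] | t == f y]%SET.
set u := undup _.
have uP t : reflect (exists i, t = f i) (t \in u).
  rewrite mem_undup; apply: (iffP mapP) => [[i _ ->]|[i ->]]; exists i => //.
  by rewrite mem_enum.
rewrite -(size_map fiber) -(card_uniqP _); last first.
  rewrite map_inj_in_uniq ?undup_uniq // => _ _ /uP[i ->] /uP[j ->].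
  by move=> /setP/(_ i); rewrite !inE eqxx => /esym/eqP.
apply: eq_card => B; apply/imsetP/mapP => [[i _ ->]|[_ /uP[i ->] ->]].
  by exists (f i) => //; apply/uP; exists i.
by exists i.
Qed.

Lemma card_induced_partition d (Omega : measurableType d)
    (Pi : forall n : nat, Omega -> {set {set 'I_n}}) (T : eqType)
    (Z : nat -> Omega -> T) (w : Omega) (n : nat) :
  random_partition Pi ->
  #|induced_partition (fun i w => Z (cluster_label Pi i w) w) n w| =
  size (undup [seq Z i w | i <- iota 0 #|Pi n w|]).
Proof.
move=> rP; rewrite /induced_partition card_preim_partition.
apply/perm_size/uniq_perm; rewrite ?undup_uniq // => x; rewrite !mem_undup.
rewrite (map_comp (fun i => Z (cluster_label Pi i w) w) val) val_enum_ord.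
rewrite (map_comp (fun i => Z i w)); apply: eq_mem_map.
exact: labels_fill_interval.
Qed.

(** * A strong law of large numbers for events *)

Lemma sum_inv_squares (R : realType) : (\sum_(k <oo) (k.+1%:R ^- 2 : R)%:E < +oo)%E.
Proof.
apply: (@le_lt_trans _ _ 2%:E); last by rewrite ltry.
apply: lime_le.
  by apply: is_cvg_nneseries => k _ _; rewrite lee_fin invr_ge0 exprn_ge0.
apply: nearW => n; rewrite big_mkord sumEFin lee_fin.
(* Telescoping bound; at n = 0 it reads 0 <= 2 because 0^-1 = 0. *)
suff : \sum_(k < n) (k.+1%:R ^- 2 : R) <= 2 - n%:R^-1.
  by move=> /le_trans; apply; rewrite lerBlDr lerDl invr_ge0.
elim: n => [|[|n] IH]; first by rewrite big_ord0 invr0; lra.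
  by rewrite big_ord_recr big_ord0 /= invr1; lra.
rewrite big_ord_recr /=; apply: le_trans (lerD IH (lexx _)) _.
have n0 : (0 : R) < n.+1%:R by rewrite ltr0n.
rewrite -(natr1 n.+1); set x : R := n.+1%:R in n0 *.
have x1 : 0 < x + 1 by rewrite addr_gt0.
have -> : (x + 1) ^- 2 = (x + 1)^-1 * (x + 1)^-1 by rewrite -exprVn expr2.
suff : (x + 1)^-1 * (x + 1)^-1 <= x^-1 * (x + 1)^-1.
  have -> : x^-1 * (x + 1)^-1 = x^-1 - (x + 1)^-1.
    by field; rewrite !gt_eqF.
  by rewrite -addrA lerD2l (addrC (- _)) lerBlDr (addrC (- _)).
by rewrite ler_pM2r ?invr_gt0 // lef_pV2 ?posrE // lerDl.
Qed.

Lemma sqrt_floor n : exists k, (k ^ 2 <= n < k.+1 ^ 2)%N.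
Proof.
elim: n => [|n [k /andP[kn nk]]]; first by exists 0%N.
have [lt|ge] := ltnP n.+1 (k.+1 ^ 2); first by exists k; rewrite lt leqW.
exists k.+1; rewrite ge /=; move: nk; rewrite !expnS !expn0; lia.
Qed.

(** Along squares is enough: the gap between consecutive squares k^2 and
    (k+1)^2 is of order k, hence negligible before k^2. *)
Lemma cvg_div_squares (R : realType) (x : nat -> R) :
  (forall n, `|x n.+1 - x n| <= 1) ->
  x (k.+1 ^ 2)%N / (k.+1 ^ 2)%:R @[k --> \oo] --> (0 : R) ->
  x n / n%:R @[n --> \oo] --> (0 : R).
Proof.
move=> step sq0.
have lip m j : `|x (m + j)%N - x m| <= j%:R.
  elim: j => [|j IH]; first by rewrite addn0 subrr normr0.
  rewrite addnS -natr1.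
  have -> : x (m + j).+1 - x m =
      (x (m + j)%N - x m) + (x (m + j).+1 - x (m + j)%N) by ring.
  exact: le_trans (ler_normD _ _) (lerD IH (step _)).
apply/cvgr0Pnorm_lt => e e0.
have e2 : 0 < e / 2 by rewrite divr_gt0.
have [K _ HK] := (cvgr0Pnorm_lt _).1 sq0 (e / 2) e2.
(* The square k0^2 below n is within 2 k0 of n, and 2 k0 <= (e/2) k0^2 as soon
   as k0 >= 4 / e. *)
pose M := (Num.truncn (4 / e)).+1.
exists ((maxn K M).+1 ^ 2)%N => // n /= nK.
have [k0 /andP[k0n nk0]] := sqrt_floor n.
have : (maxn K M < k0)%N.
  by rewrite -ltnS -(ltn_exp2r _ _ (isT : 0 < 2)%N); exact: leq_ltn_trans nk0.
case: k0 => // k in k0n nk0 *; rewrite ltnS geq_max => /andP[Kk Mk].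
have := HK k Kk; rewrite /= normrM normfV => sqk.
set q : nat := (k.+1 ^ 2)%N in sqk k0n.
have q0 : (0 : R) < q%:R by rewrite ltr0n expn_gt0.
have n0 : (0 : R) < n%:R by apply: lt_le_trans q0 _; rewrite ler_nat.
have {}sqk : `|x q| < e / 2 * q%:R.
  by move: sqk; rewrite (gtr0_norm q0) ltr_pdivrMr.
rewrite normrM normfV (gtr0_norm n0) ltr_pdivrMr //.
have xn : `|x n| <= `|x q| + (2 * k.+1)%:R.
  have -> : x n = x q + (x (q + (n - q))%N - x q) by rewrite subnKC //; ring.
  apply: le_trans (ler_normD _ _) _; rewrite lerD2l.
  apply: le_trans (lip _ _) _; rewrite ler_nat /q.
  by move: nk0 k0n; rewrite /q !expnS !expn0; lia.
have ek : 4 <= e * k.+1%:R.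
  rewrite mulrC -ler_pdivrMr //; apply/ltW/(lt_le_trans (truncnS_gt _)).
  by rewrite ler_nat; exact: leq_trans Mk _.
have qE : q%:R = k.+1%:R ^+ 2 :> R by rewrite natrX.
have nq : (q%:R : R) <= n%:R by rewrite ler_nat.
have en : e * q%:R <= e * n%:R by rewrite ler_pM2l.
apply: lt_le_trans en; apply: le_lt_trans xn _.
move: sqk; rewrite natrM qE => sqk.
have : 4 * k.+1%:R <= e * k.+1%:R ^+ 2 :> R by rewrite expr2 mulrA ler_pM2r.
by move: sqk; move: (`|x q|) (k.+1%:R) => u v; lra.
Qed.

Section PairwiseIndependentEvents.
Context {d : measure_display} {Omega : measurableType d} {R : realType}.
Variable P : probability Omega R.
Variables (E : nat -> set Omega) (p : R).
Hypothesis mE : forall i, measurable (E i).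
Hypothesis PE : forall i, P (E i) = p%:E.
Hypothesis indepE : forall i j, i != j -> P (E i `&` E j) = (p ^+ 2)%:E.

Let hits (n : nat) (w : Omega) : R := \sum_(i < n) \1_(E i) w.

Lemma measurable_hits n : measurable_fun setT (hits n).
Proof. by apply: measurable_sum => i; exact/measurable_indicP. Qed.

Lemma prob_ge0 : 0 <= p.
Proof. by rewrite -lee_fin -(PE 0%N). Qed.

Lemma hits_ge0 n w : 0 <= hits n w.
Proof. by apply: sumr_ge0 => i _; rewrite indicE. Qed.

Lemma integral_event (A : set Omega) : measurable A ->
  (\int[P]_w (\1_A w)%:E = P A)%E.
Proof. by move=> mA; rewrite integral_indic // setIT. Qed.

Lemma integral_hits n : (\int[P]_w (hits n w)%:E = (n%:R * p)%:E)%E.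
Proof.
rewrite /hits; under eq_integral do rewrite -sumEFin.
rewrite ge0_integral_sum; first last.
- by move=> i w _; rewrite lee_fin indicE.
- by move=> i; apply/measurable_EFinP; exact/measurable_indicP.
- exact: measurableT.
rewrite (eq_bigr (fun=> p%:E)); last by move=> i _; rewrite integral_event // PE.
by rewrite sumEFin sumr_const card_ord mulr_natl.
Qed.

Lemma integral_hits_sq n :
  (\int[P]_w ((hits n w) ^+ 2)%:E = ((n%:R * p) ^+ 2 + n%:R * (p - p ^+ 2))%:E)%E.
Proof.
have hits2E w : (hits n w) ^+ 2 = \sum_(i < n) \sum_(j < n) \1_(E i `&` E j) w :> R.
  rewrite expr2 big_distrlr /=; apply: eq_bigr => i _; apply: eq_bigr => j _.
  by rewrite indicI.
under eq_integral do rewrite hits2E -sumEFin.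
have mI (i j : nat) : measurable (E i `&` E j) by exact: measurableI.
rewrite ge0_integral_sum; first last.
- by move=> i w _; rewrite lee_fin sumr_ge0 // => j _; rewrite indicE.
- move=> i; apply/measurable_EFinP; apply: measurable_sum => j.
  exact/measurable_indicP.
- exact: measurableT.
have inner (i : 'I_n) :
    (\int[P]_w (\sum_(j < n) \1_(E i `&` E j) w)%:E =
     (p - p ^+ 2 + n%:R * p ^+ 2)%:E)%E.
  under eq_integral do rewrite -sumEFin.
  rewrite ge0_integral_sum; first last.
  - by move=> j w _; rewrite lee_fin indicE.
  - by move=> j; apply/measurable_EFinP; exact/measurable_indicP.
  - exact: measurableT.
  rewrite (eq_bigr (fun j => ((i == j)%:R * (p - p ^+ 2) + p ^+ 2)%:E)); last first.
    move=> j _; rewrite integral_event //; have [<-|ij] := eqVneq i j.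
      by rewrite setIid PE /=; congr _%:E; ring.
    by rewrite indepE //=; congr _%:E; ring.
  rewrite sumEFin big_split /= -mulr_suml sumr_const card_ord mulr_natl.
  rewrite (bigD1 i) //= eqxx big1 ?addr0 ?mul1r // => j ji.
  by rewrite eq_sym (negbTE ji).
under eq_bigr do rewrite inner.
by rewrite sumEFin sumr_const card_ord -mulr_natl; congr _%:E; ring.
Qed.

(** The variance is obtained from the second moment by moving the cross term to
    the other side, so that only integrals of nonnegative functions occur. *)
Lemma integral_dev_sq n :
  (\int[P]_w ((hits n w - n%:R * p) ^+ 2)%:E = (n%:R * (p - p ^+ 2))%:E)%E.
Proof.
set m := n%:R * p.
have m0 : 0 <= m by rewrite mulr_ge0 ?prob_ge0.
have mdev : measurable_fun setT (fun w => ((hits n w - m) ^+ 2)%:E).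
  apply/measurable_EFinP; apply: measurable_funX; apply: measurable_funB => //.
  exact: measurable_hits.
have : (\int[P]_w (((hits n w - m) ^+ 2)%:E + (2 * m)%:E * (hits n w)%:E) =
        \int[P]_w (((hits n w) ^+ 2)%:E + (m ^+ 2)%:E))%E.
  by apply: eq_integral => w _; rewrite -EFinM -!EFinD; congr _%:E; ring.
have dev_ge0 w : (0 <= ((hits n w - m) ^+ 2)%:E)%E by rewrite lee_fin sqr_ge0.
have mhits2 : measurable_fun setT (fun w => ((hits n w) ^+ 2)%:E).
  by apply/measurable_EFinP; apply: measurable_funX; exact: measurable_hits.
have hits2_ge0 w : (0 <= ((hits n w) ^+ 2)%:E)%E by rewrite lee_fin sqr_ge0.
have mhitsE : measurable_fun setT (fun w => (hits n w)%:E).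
  by apply/measurable_EFinP; exact: measurable_hits.
have hitsE_ge0 w : (0 <= (hits n w)%:E)%E by rewrite lee_fin hits_ge0.
have m20 : 0 <= 2 * m by rewrite mulr_ge0.
rewrite ge0_integralD //=; first last.
  by apply: measurable_funeM.
  by move=> w _; rewrite mule_ge0.
rewrite ge0_integralZl_EFin // ge0_integralD //; last first.
  by move=> w _; rewrite lee_fin sqr_ge0.
have -> : (\int[P]_w (m ^+ 2)%:E = (m ^+ 2)%:E)%E.
  rewrite integral_cst // -[RHS]mule1; congr (_ * _)%E; exact: probability_setT.
rewrite integral_hits integral_hits_sq -/m.
move=> e; rewrite -[LHS](@addeK _ ((2 * m)%:E * m%:E)%E) ?e //.
by rewrite -EFinM -EFinD; congr _%:E; ring.
Qed.

Let mean_dev_sq (k : nat) (w : Omega) : R :=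
  ((hits (k.+1 ^ 2) w - (k.+1 ^ 2)%:R * p) / (k.+1 ^ 2)%:R) ^+ 2.

Lemma integral_mean_dev_sq_le k :
  (\int[P]_w (mean_dev_sq k w)%:E <= (k.+1%:R ^- 2)%:E)%E.
Proof.
have k0 : (0 : R) < (k.+1 ^ 2)%:R by rewrite ltr0n expn_gt0.
under eq_integral do rewrite /mean_dev_sq exprMn mulrC EFinM.
rewrite ge0_integralZl_EFin //=; last first.
  apply/measurable_EFinP; apply: measurable_funX; apply: measurable_funB => //.
  exact: measurable_hits.
  by move=> w _; rewrite lee_fin sqr_ge0.
rewrite integral_dev_sq -EFinM lee_fin -natrX.
set q : R := (k.+1 ^ 2)%:R in k0 *.
have -> : q^-1 ^+ 2 * (q * (p - p ^+ 2)) = q^-1 * (p - p ^+ 2).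
  by field; rewrite gt_eqF.
rewrite ler_piMr ?invr_ge0 ?ltW //.
have := prob_ge0; have := sqr_ge0 (p - 1); nra.
Qed.

(** The squared deviations along the squares have a summable expectation, so
    their sum is almost surely finite. *)
Lemma ae_cvg_mean_dev_sq :
  {ae P, forall w, mean_dev_sq k w @[k --> \oo] --> (0 : R)}.
Proof.
have mean_dev_sq_ge0 k w : 0 <= mean_dev_sq k w by exact: sqr_ge0.
have mmean_dev_sq k : measurable_fun setT (mean_dev_sq k).
  apply: measurable_funX; apply: measurable_funM => //.
  by apply: measurable_funB => //; exact: measurable_hits.
have mmean_dev_sqE k : measurable_fun setT (fun w => (mean_dev_sq k w)%:E).
  exact/measurable_EFinP.
pose G w := (\sum_(k <oo) (mean_dev_sq k w)%:E)%E.
have iG : P.-integrable setT G.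
  apply/integrableP; split.
    by apply: ge0_emeasurable_sum => k *; [rewrite lee_fin|exact: mmean_dev_sqE].
  under eq_integral => w _.
    rewrite gee0_abs; last by apply: nneseries_ge0 => k _ _; rewrite lee_fin.
    over.
  rewrite integral_nneseries; [|exact: measurableT|exact: mmean_dev_sqE|];
    last by move=> k w _; rewrite lee_fin.
  apply: le_lt_trans (sum_inv_squares R); apply: lee_nneseries.
    by move=> k _ _; apply: integral_ge0 => w _; rewrite lee_fin.
  by move=> k _; exact: integral_mean_dev_sq_le.
have := integrable_ae measurableT iG.
apply: filterS => w /(_ I) Gfin; apply: cvg_series_cvg_0.
apply: nondecreasing_is_cvgn.
  by apply/nondecreasing_seqP => n; rewrite /series /= big_nat_recr //= lerDl.
exists (fine (G w)) => _ [n _ <-]; rewrite -lee_fin fineK // /series /= -sumEFin.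
by apply: nneseries_lim_ge => k _ _; rewrite lee_fin.
Qed.

Lemma norm_dev_step n w :
  `|(hits n.+1 w - n.+1%:R * p) - (hits n w - n%:R * p)| <= 1.
Proof.
have -> : (hits n.+1 w - n.+1%:R * p) - (hits n w - n%:R * p) = \1_(E n) w - p.
  by rewrite /hits big_ord_recr /= -natr1; ring.
have p1 : p <= 1 by rewrite -lee_fin -(PE 0%N) probability_le1.
have := prob_ge0; rewrite indicE ler_norml; move: p1.
by case: (_ \in _) => /= ? ?; apply/andP; split; lra.
Qed.

End PairwiseIndependentEvents.

(** The centred counts move by at most one at each step, so it suffices that
    their averages tend to 0 along the squares. *)
Lemma slln_events (d : measure_display) (Omega : measurableType d) (R : realType)
    (P : probability Omega R) (E : nat -> set Omega) (p : R) :
  (forall i, measurable (E i)) -> (forall i, P (E i) = p%:E) ->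
  (forall i j, i != j -> P (E i `&` E j) = (p ^+ 2)%:E) ->
  {ae P, forall w, (\sum_(i < n) \1_(E i) w) / n%:R @[n --> \oo] --> p}.
Proof.
move=> mE PE indepE.
apply: filterS (ae_cvg_mean_dev_sq mE PE indepE) => w sq0.
pose x n : R := \sum_(i < n) \1_(E i) w - n%:R * p.
have x0 : x n / n%:R @[n --> \oo] --> (0 : R).
  apply: cvg_div_squares => [n|]; first exact: norm_dev_step.
  apply/cvgr0Pnorm_lt => e e0.
  have [K _ HK] := (cvgr0Pnorm_lt _).1 sq0 (e ^+ 2) (exprn_gt0 _ e0).
  exists K => // k /= /HK /=; rewrite normrX ltr_pXn2r ?nnegrE // ltW //.
apply/subr_cvg0; apply: cvg_trans x0; apply: near_eq_cvg.
exists 1%N => // n /= n0; rewrite /x mulrBl [_ * p]mulrC mulfK //.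
by rewrite pnatr_eq0 -lt0n.
Qed.

(** * Coincidences between independent variables *)

Lemma distribution_pair d d' (Omega : measurableType d) (T : measurableType d')
    (R : realType) (P : probability Omega R) (H1 H2 : probability T R)
    (X Y : {RV P >-> T}) :
  (forall A B, measurable A -> measurable B ->
     P (X @^-1` A `&` Y @^-1` B) = (H1 A * H2 B)%E) ->
  forall D : set (T * T), measurable D ->
    P [set w | D (X w, Y w)] = (H1 \x H2)%E D.
Proof.
move=> XY D mD.
have mXY : measurable_fun setT (fun w => (X w, Y w)).
  by apply: measurable_fun_pair; exact: measurable_funPT.
pose XYrv : {RV P >-> (T * T)%type} := mfun_Sub (mem_set mXY).
have -> // := @product_measure_unique _ _ _ _ _ H1 H2 (distribution P XYrv).
Qed.

Lemma measurable_singleton d (T : measurableType d) (x : T) :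
  measurable [set xy : T * T | xy.1 = xy.2] -> measurable [set x].
Proof.
move=> mdiag; rewrite (_ : [set x] = xsection [set xy : T * T | xy.1 = xy.2] x).
  exact: measurable_xsection.
by apply/seteqP; split => y; rewrite /xsection /= inE /= => ->.
Qed.

(** By Fubini, two independent variables of law H coincide outside the atoms with
    probability the integral of H {x} over the non-atoms x, which is 0. *)
Lemma ae_atom_of_eq d d' (Omega : measurableType d) (T : measurableType d')
    (R : realType) (P : probability Omega R) (H : probability T R)
    (X Y : {RV P >-> T}) :
  measurable [set xy : T * T | xy.1 = xy.2] -> measurable (atoms H) ->
  (forall A B, measurable A -> measurable B ->
     P (X @^-1` A `&` Y @^-1` B) = (H A * H B)%E) ->
  {ae P, forall w, X w = Y w -> atoms H (X w)}.
Proof.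
move=> mdiag mA XY.
pose D := [set xy : T * T | xy.1 = xy.2] `&` (~` atoms H `*` setT).
have mD : measurable D.
  by apply: measurableI => //; apply: measurableX => //; exact: measurableC.
exists [set w | D (X w, Y w)]; split.
- have mXY : measurable_fun setT (fun w => (X w, Y w)).
    by apply: measurable_fun_pair; exact: measurable_funPT.
  by have := mXY measurableT D mD; rewrite setTI.
- apply: eq_trans (distribution_pair XY mD) _; apply: integral0_eq => x _ /=.
  have [Ax|nAx] := pselect (atoms H x).
    rewrite (_ : xsection D x = set0) ?measure0 //.
    by apply/seteqP; split => // y; rewrite /xsection /= inE => -[_ []].
  apply/eqP; rewrite -measure_le0 leNgt; apply/negP => Hx; apply: nAx.
  rewrite /atoms /=; apply: lt_le_trans Hx _; apply: le_measure.
  + by rewrite inE; exact: measurable_xsection.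
  + by rewrite inE; exact: measurable_singleton.
  + by move=> y; rewrite /xsection /= inE => -[/= ->].
- move=> w /= nXY; split; first by apply: contrapT => ne; apply: nXY => /ne.
  by split=> // AX; apply: nXY.
Qed.

(** Off the diagonal, x and y are separated by one of the balls of radius
    1 / (n+1) around a countable dense set, so the complement of the diagonal is a
    countable union of measurable rectangles. *)
Lemma measurable_diagonal (R : realType) (X : ptopologicalType) :
  polish_space R X -> measurable [set xy : borel X * borel X | xy.1 = xy.2].
Proof.
move=> [[D cD dD] [dist [[d0 dsep dC dT] metr _]]].
pose U (p : X) (n : nat) : set X := [set y | dist p y < n.+1%:R^-1].
have oU k n : open (U k n).
  rewrite openE => y yU; apply/metr; exists (n.+1%:R^-1 - dist k y).
    by rewrite subr_gt0.
  move=> z /= yz; apply: le_lt_trans (dT _ y _) _; by rewrite -ltrBrDl.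
have mU k n : measurable (U k n : set (borel X)) by exact: sub_sigma_algebra.
have [g gD] : exists g : nat -> X, D `<=` range g.
  have [->|/set0P[x0 Dx0]] := eqVneq D set0; first by exists (fun=> point).
  have /countable_injP[f finj] := cD.
  exists (fun n => xget x0 [set x | D x /\ f x = n]) => x Dx; exists (f x) => //.
  case: xgetP => [y _ [Dy fyx]|]; first by apply: finj; rewrite ?inE.
  by move=> /(_ x) [].
rewrite -[X in measurable X]setCK; apply: measurableC.
rewrite (_ : ~` _ = \bigcup_k \bigcup_n (U (g k) n `*` ~` U (g k) n)).
  apply: bigcupT_measurable => k; apply: bigcupT_measurable => n.
  by apply: measurableX => //; exact: measurableC.
apply/seteqP; split => [[x y] /= xy|]; last first.
  move=> [x y] [k _ [n _ [/= Ux nUy]]] /= exy.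
  by apply: nUy; rewrite -exy.
have dxy0 : 0 <= dist x y.
  by have := dT x y x; rewrite d0 (dC y x); lra.
have dxy : 0 < dist x y.
  rewrite lt_neqAle dxy0 andbT eq_sym; apply/eqP => /dsep; exact: xy.
have [n nd] : exists n : nat, n.+1%:R^-1 < dist x y / 2.
  have e2 : 0 < dist x y / 2 by rewrite divr_gt0.
  exists (Num.truncn (dist x y / 2)^-1); rewrite invf_plt ?posrE //.
  exact: truncnS_gt.
have xU : U x n x by rewrite /U /= d0 invr_gt0.
have [p [xp /gD[k _ gk]]] := dD (U x n) (ex_intro _ x xU) (oU x n).
exists k => //; exists n => //; rewrite gk; split; first by rewrite /U /= dC.
rewrite /U /=; apply/negP; rewrite -leNgt.
have := dT x p y; move: xp; rewrite /U /=; move: nd.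
by move: (n.+1%:R^-1) => v; lra.
Qed.

(** * Number of distinct values of an i.i.d. sequence *)

Lemma iid_pair d d' (Omega : measurableType d) (T : measurableType d')
    (R : realType) (P : probability Omega R) (H : probability T R)
    (Z : nat -> {RV P >-> T}) (i j : nat) (A B : set T) :
  iid_with_law H Z -> i != j -> measurable A -> measurable B ->
  P (Z i @^-1` A `&` Z j @^-1` B) = (H A * H B)%E.
Proof.
move=> [indep law] ij mA mB.
pose C k := if k == i then Z k @^-1` A else Z k @^-1` B.
have := indep [fset i; j]%fset C; rewrite big_fsetU1 ?inE //= big_seq_fset1.
rewrite /C eqxx eq_sym (negbTE ij) -(law i A mA) -(law j B mB) => <-.
- congr (P _); apply/seteqP; split => [w [Aw Bw] k /=|w CW].
    by rewrite !inE => /orP[] /eqP ->; rewrite ?eqxx // eq_sym (negbTE ij).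
  split; first by have := CW i; rewrite /= !inE !eqxx; exact.
  by have := CW j; rewrite /= !inE !eqxx orbT eq_sym (negbTE ij); exact.
- by move=> k _; case: ifP => _; [exists A|exists B] => //; rewrite setTI.
Qed.

Definition distinct (T : eqType) (z : nat -> T) (k : nat) : nat :=
  size (undup [seq z i | i <- iota 0 k]).

(** When repetitions occur only inside A, every term outside A counts once. *)
Lemma distinct_split (T : eqType) (A : {pred T}) (z : nat -> T) (k : nat) :
  (forall i j, i != j -> z i = z j -> z i \in A) ->
  distinct z k = (\sum_(i < k) (z i \notin A)
    + size (undup [seq x <- [seq z i | i <- iota 0 k] | x \in A]))%N.
Proof.
move=> zA; rewrite /distinct.
rewrite -(count_predC [in A]) -!size_filter !filter_undup addnC; congr (_ + _)%N.
rewrite undup_id.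
  rewrite size_filter count_map -sum1_count big_mkcond /=.
  rewrite -(big_mkord xpredT (fun i => nat_of_bool (z i \notin A))).
  by rewrite /index_iota subn0; apply: eq_bigr => i _ /=; case: (_ \in _).
rewrite filter_map map_inj_in_uniq ?filter_uniq ?iota_uniq // => i j.
rewrite !mem_filter /= => /andP[iA _] _ zij; apply/eqP/negPn/negP => ij.
by move: iA; rewrite (zA i j).
Qed.

Lemma size_undup_in (T : choiceType) (A : {fset T}) (s : seq T) :
  (size (undup [seq x <- s | x \in A]) <= #|` A|)%N.
Proof.
apply: uniq_leq_size; rewrite ?undup_uniq // => x.
by rewrite mem_undup mem_filter => /andP[].
Qed.

Lemma distinct_cover (T : choiceType) (A : {fset T}) (z : nat -> T) :
  (forall i, z i \in A) -> (forall x, x \in A -> exists i, z i = x) ->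
  \forall k \near \oo, distinct z k = #|` A|.
Proof.
move=> zA Az.
have [K HK] : exists K, forall x, x \in A -> exists2 i, (i < K)%N & z i = x.
  suff gen (s : seq T) : (forall x, x \in s -> exists i, z i = x) ->
      exists K, forall x, x \in s -> exists2 i, (i < K)%N & z i = x by exact: gen.
  elim: s => [|y s IH] sz; first by exists 0%N.
  have [i iy] := sz y (mem_head _ _).
  have [x xs|K HK] := IH; first by apply: sz; rewrite inE xs orbT.
  exists (maxn i.+1 K) => x; rewrite inE => /orP[/eqP ->|/HK[j jK jx]].
    by exists i => //; rewrite leq_max leqnn.
  by exists j => //; rewrite leq_max jK orbT.
exists K => // k /= Kk; apply/perm_size/uniq_perm; rewrite ?undup_uniq ?fset_uniq //.
move=> x; rewrite mem_undup; apply/mapP/idP => [[i _ ->]//|/HK[i iK <-]].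
by exists i => //; rewrite mem_iota /= add0n (leq_trans iK).
Qed.

Lemma cvg_random_index (R : realType) (K : nat -> nat) (c : nat -> R) (s : R) :
  0 < s -> c n @[n --> \oo] --> +oo -> (K n)%:R / c n @[n --> \oo] --> s ->
  K n @[n --> \oo] --> \oo.
Proof.
move=> s0 cy Kc.
apply/cvgnyPge => A; have s2 : 0 < s / 2 by rewrite divr_gt0.
near=> n.
have Kn : s / 2 < (K n)%:R / c n.
  near: n; apply: (cvgr_gt s Kc); rewrite ltr_pdivrMr //; lra.
have cn : A%:R / (s / 2) + 1 <= c n by near: n; exact: (cvgryPge _).1 cy _.
have cn0 : 0 < c n.
  by apply: lt_le_trans cn; rewrite ltr_wpDl // divr_ge0 // ltW.
rewrite -(ler_nat R); apply/ltW; move: Kn; rewrite ltr_pdivlMr //.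
apply: le_lt_trans; rewrite mulrC -ler_pdivrMr //.
by apply: le_trans cn; rewrite lerDl.
Unshelve. all: by end_near. Qed.

(** D (K n) / c n is (D (K n) / K n) * (K n / c n); where K n = 0, both vanish
    because D 0 = 0. *)
Lemma cvg_subsample (R : realType) (D K : nat -> nat) (c : nat -> R) (s l : R) :
  D 0%N = 0%N -> K n @[n --> \oo] --> \oo ->
  (D k)%:R / k%:R @[k --> \oo] --> l ->
  (K n)%:R / c n @[n --> \oo] --> s ->
  (D (K n))%:R / c n @[n --> \oo] --> l * s.
Proof.
move=> D0 Koo Dl Ks.
have -> : (fun n => (D (K n))%:R / c n) =
    (fun n => ((D (K n))%:R / (K n)%:R) * ((K n)%:R / c n)).
  apply/funext => n; have [->|K0] := eqVneq (K n) 0%N; first by rewrite D0 !mul0r.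
  by rewrite mulrA divfK // pnatr_eq0.
by apply: cvgM Ks; exact: (cvg_comp _ _ Koo Dl).
Qed.

Section DistinctValues.
Context d d' (Omega : measurableType d) (T : measurableType d') (R : realType).
Variables (P : probability Omega R) (H : probability T R).
Variable Z : nat -> {RV P >-> T}.
Hypothesis iidZ : iid_with_law H Z.

Lemma frequency_cvg (A : set T) : measurable A ->
  {ae P, forall w,
    (\sum_(i < n) \1_(Z i @^-1` A) w) / n%:R @[n --> \oo] --> fine (H A)}.
Proof.
move=> mA.
have HA : H A = (fine (H A))%:E by rewrite fineK // fin_num_measure.
apply: (@slln_events _ _ _ P (fun i => Z i @^-1` A) (fine (H A))) => [i|i|i j ij].
- exact: measurable_funPTI.
- by rewrite -HA -(iidZ.2 i A mA).
- by rewrite (iid_pair iidZ ij mA mA) HA.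
Qed.

Hypothesis mdiag : measurable [set xy : T * T | xy.1 = xy.2].
Hypothesis finA : finite_set (atoms H).

Lemma measurable_atoms : measurable (atoms H).
Proof.
have -> : atoms H = \bigcup_(x in atoms H) [set x].
  by apply/seteqP; split => [x Hx|x [y Hy ->]] //; exists x.
by apply: fin_bigcup_measurable => // x _; exact: measurable_singleton.
Qed.

Lemma ae_coincidence_atom :
  {ae P, forall w, forall i j, i != j -> Z i w = Z j w -> atoms H (Z i w)}.
Proof.
apply: ae_foralln => i; apply: ae_foralln => j.
have [->|ij] := eqVneq i j; first exact: aeW.
have := ae_atom_of_eq mdiag measurable_atoms (X := Z i) (Y := Z j)
  (fun A B => iid_pair iidZ ij).
by apply: filterS => w h _.
Qed.

(** Non-atomic terms are pairwise distinct and have asymptotic frequency 1 - a;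
    the finitely many atoms contribute a bounded number of values. *)
Lemma distinct_cvg_rate :
  {ae P, forall w, (distinct (Z ^~ w) n)%:R / n%:R @[n --> \oo]
    --> 1 - atomic_mass H}.
Proof.
have mAc := measurableC measurable_atoms.
apply: filterS2 ae_coincidence_atom (frequency_cvg mAc) => w coin freq.
have pE : 1 - atomic_mass H = fine (H (~` atoms H)).
  rewrite /atomic_mass probability_setC; last exact: measurable_atoms.
  by rewrite fineB // fin_num_measure //; exact: measurable_atoms.
rewrite pE -[X in _ --> X]addr0.
pose r n := size (undup [seq x <- [seq Z i w | i <- iota 0 n]
                        | x \in fset_set (atoms H)]).
have -> : (fun n => (distinct (Z ^~ w) n)%:R / n%:R : R) =
    (fun n => (\sum_(i < n) \1_(Z i @^-1` ~` atoms H) w) / n%:R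
      + (r n)%:R / n%:R).
  apply/funext => n; rewrite (@distinct_split _ [in fset_set (atoms H)]).
    rewrite natrD mulrDl natr_sum; congr (_ / _ + _); apply: eq_bigr => i _.
    by rewrite indicE /= in_fset_set // in_setC.
  by move=> i j ij zij; rewrite in_fset_set // inE; exact: coin zij.
apply: cvgD => //.
have bound : (#|` fset_set (atoms H)|%:R / n%:R : R) @[n --> \oo] --> (0 : R).
  rewrite -[X in _ --> X](mulr0 (#|` fset_set (atoms H)|%:R)).
  apply: cvgM; first exact: cvg_cst.
  by rewrite -cvg_shiftS; exact: cvg_harmonic.
apply: squeeze_cvgr bound; last exact: cvg_cst.
apply: nearW => n; rewrite divr_ge0 //= ler_wpM2r ?invr_ge0 //.
by rewrite ler_nat size_undup_in.
Qed.

(** With full mass on the atoms no other value occurs, and each atom does occur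
    since it has a positive asymptotic frequency. *)
Lemma distinct_eventually_const : atomic_mass H = 1 ->
  {ae P, forall w, \forall n \near \oo,
    distinct (Z ^~ w) n = #|` fset_set (atoms H)|}.
Proof.
move=> a1.
have mA := measurable_atoms.
have all_in : {ae P, forall w, forall i, atoms H (Z i w)}.
  apply: ae_foralln => i; exists (Z i @^-1` (~` atoms H)); split => //.
  - by apply: measurable_funPTI; exact: measurableC.
  - apply: eq_trans (iidZ.2 i _ (measurableC mA)) _.
    rewrite probability_setC // -(@fineK _ (H (atoms H))) ?fin_num_measure //.
    by rewrite -/(atomic_mass H) a1 subee.
pose A := fset_set (atoms H).
have all_seen : {ae P, forall w, forall k, (k < size A)%N ->
    exists i, Z i w = nth point A k}.
  apply: ae_foralln => k; have [kA|Ak] := ltnP k (size A); last first.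
    by apply: aeW => w.
  set x := nth point A k.
  have Hx : atoms H x by have := mem_nth point kA; rewrite in_fset_set // inE.
  have mx : measurable [set x] by exact: measurable_singleton.
  (* An atom that is never seen would have asymptotic frequency 0. *)
  apply: filterS (frequency_cvg mx) => w freq _.
  apply: contrapT => /forallNP never; move: Hx; rewrite /atoms /=.
  have -> : H [set x] = (fine (H [set x]))%:E by rewrite fineK // fin_num_measure.
  suff -> : fine (H [set x]) = 0 by rewrite ltxx.
  rewrite -(cvg_lim (@Rhausdorff R) freq).
  rewrite (_ : (fun n => _) = cst 0); first exact: lim_cst.
  apply/funext => n /=; rewrite big1 ?mul0r // => i _.
  by rewrite indicE memNset //= => Zx; apply: (never i).
apply: filterS2 all_in all_seen => w Zin seen; apply: distinct_cover.
  by move=> i; rewrite in_fset_set // inE.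
move=> x /(nthP point)[k kA <-]; exact: seen.
Qed.

End DistinctValues.

Theorem proposition6 (R : realType) (d : measure_display)
  (Omega : measurableType d) (P : probability Omega R)
  (Pi : forall n : nat, Omega -> {set {set 'I_n}}) (q : seq nat -> R)
  (X : ptopologicalType) (H : probability (borel X) R)
  (Z : nat -> {RV P >-> borel X})
  (c : nat -> R) (S : {RV P >-> R}) :
  random_partition Pi ->
  exchangeable P Pi ->
  is_EPPF P Pi q ->
  proper_frequencies P Pi ->
  polish_space R X ->
  iid_with_law H Z ->
  independent_systems P (sigma_partition Pi) (sigma_variables Z) ->
  let xi := fun (i : nat) (w : Omega) => Z (cluster_label Pi i w) w in
  let Pi' := induced_partition xi in
  let a := atomic_mass H in
  0 < a ->
  (forall n, (0 < n)%N -> 0 < c n) ->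
  c n @[n --> \oo] --> +oo ->
  {ae P, forall w, 0 < S w} ->
  {ae P, forall w, #|Pi n w|%:R / c n @[n --> \oo] --> S w} ->
  finite_set (atoms H) ->
  (a < 1 ->
   {ae P, forall w, #|Pi' n w|%:R / c n @[n --> \oo] --> (1 - a) * S w}) /\
  (a = 1 ->
   {ae P, forall w, #|Pi' n w|%:R @[n --> \oo] --> (#|` fset_set (atoms H)|%:R : R)}).
Proof.
move=> rP _ _ _ polX iidZ _ xi Pi' a a0 _ c_infty S0 K_cvg finA.
have mdiag := measurable_diagonal polX.
(* From here on Pi enters only through its number of blocks. *)
have Pi'E n w : #|Pi' n w| = distinct (Z ^~ w) #|Pi n w|.
  exact: (card_induced_partition (Z : nat -> Omega -> borel X)).
split=> a1.
- apply: filterS3 S0 K_cvg (distinct_cvg_rate iidZ mdiag finA) => w Sw Kw Dw.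
  rewrite (_ : (fun n => _) = fun n => (distinct (Z ^~ w) #|Pi n w|)%:R / c n).
    exact: cvg_subsample (erefl _) (cvg_random_index Sw c_infty Kw) Dw Kw.
  by apply/funext => n; rewrite Pi'E.
- have D_const := distinct_eventually_const iidZ mdiag finA a1.
  apply: filterS3 S0 K_cvg D_const => w Sw Kw Dw.
  apply: cvg_near_cst.
  have Koo : #|Pi n w| @[n --> \oo] --> \oo := cvg_random_index Sw c_infty Kw.
  have near_card := Koo _ Dw; rewrite /nbhs /= in near_card.
  by apply: filterS near_card => n /= Dn; rewrite Pi'E Dn.
Qed.
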